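(* Let $(V,d)$ be a finite quasimetric space. Then its interval function $I_d:V\times V\to 2^V$, given by $I_d(u,v)=\{w\in V\mid d(u,w)+d(w,v)=d(u,v)\}$ if $d(u,v)<\infty$ and $I_d(u,v)=\emptyset$ if $d(u,v)=\infty$, is a geometric directed transit function.
   Context: A finite quasimetric space $(V,d)$ consists of a finite set $V$ and a function $d:V\times V\to\mathbb{R}_+\cup\{\infty\}$ (nonnegative values) such that for all $x,y,z\in V$: (i) $d(x,y)=0$ if and only if $x=y$; (ii) $d(x,z)+d(z,y)\geq d(x,y)$. Symmetry of $d$ is not assumed. A directed transit function on a finite set $V$ is a function $R:V\times V\to 2^V$ satisfying (t0) for all $u,v,w\in V$: if $R(u,w)\neq\emptyset$ and $R(w,v)\neq\emptyset$ then $R(u,v)\neq\emptyset$; (t1) for all $u,v\in V$: if $R(u,v)\neq\emptyset$ then $\{u,v\}\subseteq R(u,v)$; (t3) $R(u,u)=\{u\}$ for all $u\in V$. A directed transit function is geometric if it satisfies (tr2) for all $u,v,w\in V$ with $u\neq v$: if $R(u,w)=\emptyset$ or $R(w,v)=\emptyset$ then $w\notin R(u,v)$; (b2) $w\in R(u,v)$ implies $R(u,w)\cup R(w,v)\subseteq R(u,v)$, for all $u,v,w\in V$; (b3$_1$) $x\in R(u,v)$ and $y\in R(u,x)$ implies $x\in R(y,v)$, for all $u,v,x,y\in V$; (b3$_2$) $x\in R(u,v)$ and $y\in R(x,v)$ implies $x\in R(u,y)$, for all $u,v,x,y\in V$. *)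

(* Defs.v *)
From mathcomp Require Import all_boot all_order all_algebra.
From mathcomp Require Import reals constructive_ereal.

Set Implicit Arguments.
Unset Strict Implicit.
Unset Printing Implicit Defensive.

Local Open Scope ereal_scope.

(* A distance with values in [0, +oo] is a function into \bar R that is
   nonnegative; this excludes -oo. *)
Record quasimetric (R : realType) (V : finType) (d : V -> V -> \bar R) : Prop :=
  Quasimetric {
    qm_ge0 : forall x y : V, 0 <= d x y;
    qm_eq0 : forall x y : V, d x y = 0 <-> x = y;
    qm_triangle : forall x y z : V, d x z + d z y >= d x y }.

Record directed_transit (V : finType) (I : V -> V -> {set V}) : Prop :=
  DirectedTransit {
    transit_t0 : forall u v w : V,
      I u w <> set0 -> I w v <> set0 -> I u v <> set0;
    transit_t1 : forall u v : V, I u v <> set0 -> [set u; v] \subset I u v;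
    transit_t3 : forall u : V, I u u = [set u] }.

Record geometric_directed_transit (V : finType) (I : V -> V -> {set V}) : Prop :=
  GeometricDirectedTransit {
    geometric_transit : directed_transit I;
    geometric_tr2 : forall u v w : V,
      u <> v -> I u w = set0 \/ I w v = set0 -> w \notin I u v;
    geometric_b2 : forall u v w : V,
      w \in I u v -> I u w :|: I w v \subset I u v;
    geometric_b31 : forall u v x y : V,
      x \in I u v -> y \in I u x -> x \in I y v;
    geometric_b32 : forall u v x y : V,
      x \in I u v -> y \in I x v -> x \in I u y }.

Definition interval_function (R : realType) (V : finType) (d : V -> V -> \bar R)
    (u v : V) : {set V} :=
  if d u v < +oo then [set w | d u w + d w v == d u v] else set0.

(* Main.v *)
Require Import Defs.
From mathcomp Require Import all_boot all_order all_algebra.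
From mathcomp Require Import reals constructive_ereal.
From mathcomp Require Import lra.

(** A point [w] lies between [u] and [v] exactly when all three distances are
    finite and the triangle inequality through [w] is tight.  If
    [u - x - v] and [u - y - x] are tight, then so is the broken line
    [u - y - x - v]; the triangle inequalities for [y - x - v] and [u - y - v]
    squeeze [d y v] to [d y x + d x v], which gives both the transitivity and
    the betweenness axioms. *)

Import Order.TTheory GRing.Theory Num.Theory.
Local Open Scope ring_scope.

Section IntervalFunction.
Context {R : realType} {V : finType} {d : V -> V -> \bar R}.
Context (hd : quasimetric d).

Let I := interval_function d.

Lemma quasimetric_xx (u : V) : d u u = 0%E.
Proof. exact/(qm_eq0 hd). Qed.

Lemma quasimetric_fin (u v : V) :
  (d u v < +oo)%E -> exists r : R, d u v = r%:E.
Proof. by have := qm_ge0 hd u v; case: (d u v) => // r _ _; exists r. Qed.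

Lemma quasimetric_fin_trans (u v w : V) :
  (d u w < +oo)%E -> (d w v < +oo)%E -> (d u v < +oo)%E.
Proof. by move=> uw wv; rewrite (le_lt_trans (qm_triangle hd u v w)) ?lte_add_pinfty. Qed.

(** Real witnesses for the three distances reduce the later betweenness arguments to linear
    arithmetic over [R]. *)
Lemma in_interval (u v w : V) :
  reflect (exists a b : R, [/\ d u w = a%:E, d w v = b%:E & d u v = (a + b)%:E])
          (w \in I u v).
Proof.
apply: (iffP idP) => [|[a [b [uw wv uv]]]]; last first.
  by rewrite /I /interval_function uv ltry inE uw wv.
rewrite /I /interval_function; case: ifP => [uv|_]; last by rewrite inE.
rewrite inE => /eqP; move: uv.
(* Nonnegativity rules out [-oo], and a summand [+oo] would make [d u v] infinite. *)
have := qm_ge0 hd u w; have := qm_ge0 hd w v.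
case: (d u w) => [a| |] //; case: (d w v) => [b| |] // _ _ uv uwv;
  try by rewrite -uwv in uv.
by exists a, b.
Qed.

(** When [d u v] is finite, [u] itself is a member because [d u u = 0]. This turns (t0) and (tr2)
    into claims about finiteness. *)
Lemma interval_neq0 (u v : V) : I u v <> set0 <-> (d u v < +oo)%E.
Proof.
split=> [|uv].
  by rewrite /I /interval_function; case: ifP.
apply/eqP/set0Pn; exists u.
by rewrite /I /interval_function uv inE quasimetric_xx add0e.
Qed.

Lemma interval_endpoints (u v : V) : I u v <> set0 -> [set u; v] \subset I u v.
Proof.
move/interval_neq0/quasimetric_fin => [r uv].
rewrite subUset !sub1set; apply/andP; split; apply/in_interval.
  by exists 0, r; rewrite quasimetric_xx add0r.
by exists r, 0; rewrite quasimetric_xx addr0.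
Qed.

Lemma interval_xx (u : V) : I u u = [set u].
Proof.
apply/setP=> w; rewrite inE; apply/in_interval/eqP => [[a [b []]]|->]; last first.
  by exists 0, 0; rewrite quasimetric_xx addr0.
(* Nonnegative [a] and [b] with sum [d u u = 0] both vanish, so [d u w = 0]. *)
move=> uw wu; rewrite quasimetric_xx => -[] ab.
have := qm_ge0 hd u w; have := qm_ge0 hd w u; rewrite uw wu !lee_fin => b0 a0.
by apply/esym/(qm_eq0 hd); rewrite uw; congr EFin; lra.
Qed.

Lemma interval_left {u v x y : V} :
  x \in I u v -> y \in I u x -> y \in I u v /\ x \in I y v.
Proof.
move=> /in_interval[a [c [ux xv uv]]] /in_interval[b [e [uy yx]]].
rewrite ux => -[] abe.
have [|f yv] := @quasimetric_fin y v.
  by apply: (@quasimetric_fin_trans _ _ x); rewrite ?yx ?xv ltry.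
(* With [a = b + e], these two inequalities bound [f] above and below by [e + c]. *)
have := qm_triangle hd y v x; have := qm_triangle hd u v y.
rewrite uv uy yv yx xv -!EFinD !lee_fin => l1 l2.
split; apply/in_interval.
  by exists b, f; split=> //; rewrite uv; congr EFin; lra.
by exists e, c; split=> //; rewrite yv; congr EFin; lra.
Qed.

(** Mirror image of [interval_left], argued separately since [d] may be asymmetric: here [d u y] is
    squeezed to [d u x + d x y]. *)
Lemma interval_right {u v x y : V} :
  x \in I u v -> y \in I x v -> y \in I u v /\ x \in I u y.
Proof.
move=> /in_interval[a [c [ux xv uv]]] /in_interval[b [e [xy yv]]].
rewrite xv => -[] cbe.
have [|f uy] := @quasimetric_fin u y.
  by apply: (@quasimetric_fin_trans _ _ x); rewrite ?ux ?xy ltry.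
have := qm_triangle hd u y x; have := qm_triangle hd u v y.
rewrite uv uy yv xy ux -!EFinD !lee_fin => l1 l2.
split; apply/in_interval.
  by exists f, e; split=> //; rewrite uv; congr EFin; lra.
by exists a, b; split=> //; rewrite uy; congr EFin; lra.
Qed.

End IntervalFunction.

Theorem lemma39 (R : realType) (V : finType) (d : V -> V -> \bar R)
    (hd : quasimetric d) :
  geometric_directed_transit (interval_function d).
Proof.
split.
- split.
  + move=> u v w /(interval_neq0 hd) uw /(interval_neq0 hd) wv.
    exact/(interval_neq0 hd)/(quasimetric_fin_trans hd _ _ w).
  + exact: interval_endpoints hd.
  + exact: interval_xx hd.
(* A point of the interval is at finite distance from [u] and to [v], so neither [I u w] nor [I w v]
   is empty. *)
- move=> u v w _ uw0; apply/negP => /(in_interval hd)[a [b [uw wv _]]].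
  by case: uw0; apply/(interval_neq0 hd); rewrite ?uw ?wv ltry.
- move=> u v w wI; rewrite subUset; apply/andP; split; apply/subsetP => y yI.
    exact: (interval_left hd wI yI).1.
  exact: (interval_right hd wI yI).1.
- by move=> u v x y xI yI; case: (interval_left hd xI yI).
- by move=> u v x y xI yI; case: (interval_right hd xI yI).
Qed.
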